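(* The following graphs are not $D_8$-RA, where $D_8$ is the dihedral group of order $8$: (a) the cube graph $Q_d$ with $d\ge 1$ odd; (b) the folded cube $\square_d$, with $2^{d-1}$ vertices, where $d\geq 2$ and $d$ is odd or $d=2$.
   Context: Graphs are finite, undirected, simple. $Q_d$ is the $d$-dimensional cube graph: its $2^d$ vertices are the bit strings of length $d$, two being adjacent iff they differ in exactly one bit. The folded cube $\square_d$ is the graph obtained from the hypercube $Q_{d-1}$ by additionally joining opposite vertices (those at distance $d-1$, i.e. bitwise complements) by an edge (keeping the graph simple). For a group $G$ and a graph $\Gamma$ with vertices $v_1,\dots,v_n$, the graph power $G^\Gamma$ is the subgroup of $G^n$ generated by the elements $g^{v}$, $g\in G$, $v$ a vertex, where $g^v$ has $g$ in each coordinate corresponding to a vertex of the closed neighborhood of $v$ and the identity in all other coordinates. $\Gamma$ is $G$-RA if $[G,G]^{n}\le G^\Gamma$, where $[G,G]$ is the commutator subgroup. *)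

(* Defs.v *)
From mathcomp Require Import all_boot all_fingroup all_solvable.

Set Implicit Arguments.
Unset Strict Implicit.
Unset Printing Implicit Defensive.

Local Open Scope group_scope.

Record sgraph := SGraph {
  vertex :> finType;
  adj : rel vertex;
  adj_sym : symmetric adj;
  adj_irrefl : irreflexive adj
}.

Definition closed_nbhd (Gam : sgraph) (v : Gam) : {set Gam} :=
  [set w | (w == v) || adj v w].

(* The power is taken as a constant dependent product, because that is the
   type of finite functions that carries a finGroupType structure. *)
Definition gpower_type (gT : finGroupType) (Gam : sgraph) : finGroupType :=
  {dffun forall _ : Gam, gT}.

Definition gpower_gen (gT : finGroupType) (Gam : sgraph) (g : gT) (v : Gam) :
    gpower_type gT Gam :=
  finfun (fun w : Gam => if w \in closed_nbhd v then g else 1).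

Definition gpower (gT : finGroupType) (G : {group gT}) (Gam : sgraph) :
    {set gpower_type gT Gam} :=
  <<[set gpower_gen g v | g : gT in G, v : Gam]>>.

Definition is_RA (gT : finGroupType) (G : {group gT}) (Gam : sgraph) : bool :=
  setXn (fun _ : Gam => [~: G, G]) \subset gpower G Gam.

Section Cubes.

Variable d : nat.
Implicit Types x y : d.-tuple bool.

Definition bit_diff x y : {set 'I_d} := [set i | tnth x i != tnth y i].

Definition cube_adj x y : bool := #|bit_diff x y| == 1%N.

Definition opposite x y : bool := y == [tuple of map negb x].

(* The test x != y only matters for d = 0, where the empty string is its own
   complement. *)
Definition cube_opp_adj x y : bool :=
  (x != y) && (cube_adj x y || opposite x y).

Lemma bit_diffC x y : bit_diff x y = bit_diff y x.
Proof. by apply/setP => i; rewrite !inE eq_sym. Qed.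

Lemma cube_adj_sym : symmetric cube_adj.
Proof. by move=> x y; rewrite /cube_adj bit_diffC. Qed.

Lemma cube_adj_irrefl : irreflexive cube_adj.
Proof.
move=> x; rewrite /cube_adj (_ : bit_diff x x = set0) ?cards0 //.
by apply/setP => i; rewrite !inE eqxx.
Qed.

Lemma opposite_sym : symmetric opposite.
Proof.
suff H x y : opposite x y -> opposite y x by move=> x y; apply/idP/idP; apply: H.
move/eqP->; apply/eqP/val_inj; rewrite /= -map_comp map_id_in //.
by move=> b _ /=; rewrite negbK.
Qed.

Lemma cube_opp_adj_sym : symmetric cube_opp_adj.
Proof.
by move=> x y; rewrite /cube_opp_adj eq_sym cube_adj_sym opposite_sym.
Qed.

Lemma cube_opp_adj_irrefl : irreflexive cube_opp_adj.
Proof. by move=> x; rewrite /cube_opp_adj eqxx. Qed.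

End Cubes.

Definition cube_graph (d : nat) : sgraph :=
  SGraph (@cube_adj_sym d) (@cube_adj_irrefl d).

(* Obtained from the cube of dimension d - 1; meaningful only for d > 0. *)
Definition folded_cube_graph (d : nat) : sgraph :=
  SGraph (@cube_opp_adj_sym d.-1) (@cube_opp_adj_irrefl d.-1).

Lemma card_cube_graph (d : nat) : #|cube_graph d| = (2 ^ d)%N.
Proof. by rewrite card_tuple card_bool. Qed.

Lemma card_folded_cube_graph (d : nat) : #|folded_cube_graph d| = (2 ^ d.-1)%N.
Proof. by rewrite card_tuple card_bool. Qed.

(* Main.v *)
Require Import Defs.
From mathcomp Require Import all_boot all_fingroup all_solvable.
From HB Require Import structures.

(** A parity that vanishes on every generator of the graph power, but not on
    the power of the derived subgroup, separates the two.  Identify [D_8] with the Heisenberg group over the field with two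
    elements: triples [(a, b, c)] of bits, where [a] and [b] add and [c] adds
    up to the cocycle [a b'].  The centre, which is also the commutator
    subgroup, is generated by [(0, 0, 1)].  An element of the power
    [D_8 ^ n] is thus a triple of bit vectors indexed by the vertices, and
    the sum over all vertices of the third vector changes under a product by
    the scalar product of [a] with [b'].

    Call a graph evenly overlapping if any two closed neighbourhoods, equal
    or not, meet in an even number of vertices: over the field with two
    elements, the matrix [A + I] has square zero.  A generator [g ^ v] of the
    graph power has its three vectors among [0] and the indicator of the
    closed neighbourhood of [v].  So all scalar products above vanish, and so
    does the total of [c] on each generator; hence that total vanishes on the
    whole graph power ([gpower_parity]).  The element with the
    nontrivial commutator at a single vertex has total [1], so it is missed
    ([even_overlap_not_RA], [D8_not_RA]).

    It remains to see that the cubes concerned are evenly overlapping.  Both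
    families are Cayley graphs of the group of bit strings, an elementary
    abelian 2-group.  The closed neighbourhoods of [v <> w] meet in a set
    stable under the translation by [v + w], which has no fixed point, and the
    closed neighbourhood of [v] has one vertex more than the degree
    ([even_overlap_Cayley]).  The degree is odd in all the cases considered:
    it is [d], or [1] for the folded cube on two vertices.  *)

Set Implicit Arguments.
Unset Strict Implicit.
Unset Printing Implicit Defensive.

Local Open Scope group_scope.

(** * Even overlaps and the parity of a graph power *)

(** The indicators of the closed neighbourhoods span a self-orthogonal binary
    code. *)
Definition even_overlap (Gam : sgraph) : Prop :=
  forall u v : Gam, ~~ odd #|closed_nbhd u :&: closed_nbhd v|.

Lemma odd_card_addb (T : finType) (A : {set T}) (b : bool) :
  \big[addb/false]_(x in A) b = odd #|A| && b.
Proof.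
rewrite big_const; elim: #|A| => //= n ->.
by case: b (odd n) => [] [].
Qed.

Section HeisenbergCoordinates.

(* The maps [a], [b], [c] are the coordinates of a morphism to the Heisenberg
   group over the field with two elements. *)
Variables (gT : finGroupType) (a b c : gT -> bool).
Hypothesis aM : forall g h, a (g * h) = a g (+) a h.
Hypothesis bM : forall g h, b (g * h) = b g (+) b h.
Hypothesis cM : forall g h, c (g * h) = c g (+) c h (+) (a g && b h).

Lemma coord1 : [/\ a 1 = false, b 1 = false & c 1 = false].
Proof.
have a1 : a 1 = false by have := aM 1 1; rewrite mulg1; case: (a 1).
have b1 : b 1 = false by have := bM 1 1; rewrite mulg1; case: (b 1).
by split=> //; have := cM 1 1; rewrite mulg1 a1; case: (c 1).
Qed.

(** Compare the coordinates of [g h] and of [h g [~ g, h]]: the commutator of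
    two elements measures the failure of the cocycle to be symmetric. *)
Lemma coord_commg (g h : gT) :
    [/\ a [~ g, h] = false, b [~ g, h] = false
      & c [~ g, h] = (a g && b h) (+) (a h && b g)].
Proof.
have e : g * h = h * g * [~ g, h] by rewrite commgC.
move: [~ g, h] e => z e.
have ea := congr1 a e; have eb := congr1 b e; have ec := congr1 c e.
rewrite !aM in ea; rewrite !bM in eb; rewrite !cM !aM in ec.
have az : a z = false by case: (a g) (a h) (a z) ea => [] [] [].
have bz : b z = false by case: (b g) (b h) (b z) eb => [] [] [].
split=> //; move: ec; rewrite bz andbF addbF.
by case: (c g) (c h) (c z) (a g) (b g) (a h) (b h)
  => [] [] [] [] [] [] [].
Qed.

(** Induction on the number of generators in a product.  Multiplying by [g ^ u]
    adds to the total of [c] the bit [b g] times the sum of [a] over the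
    closed neighbourhood of [u]; this is why the orthogonality of [a] to all
    closed neighbourhoods has to be carried along. *)
Lemma gpower_parity (Gam : sgraph) (f : gpower_type gT Gam) :
    even_overlap Gam -> f \in gpower [set: gT] Gam ->
  (forall v, \big[addb/false]_(w in closed_nbhd v) a (f w) = false)
  /\ \big[addb/false]_w c (f w) = false.
Proof.
move=> evenG /gen_prodgP[n [gs gsP ->]] {f}.
have [a1 b1 c1] := coord1.
elim: n => [|n IHn] in gs gsP *.
  by split=> [v|]; rewrite big_ord0 big1 // => w _; rewrite ffunE.
rewrite big_ord_recr /=; set f := (\prod_(i < n) _).
have {IHn} [IHa IHc] := IHn (fun i => gs (widen_ord (leqnSn n) i))
  (fun i => gsP _); rewrite -/f in IHa IHc.
have /imset2P[g u _ _ ->] := gsP ord_max.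
(* This vanishes by even overlap both when [A] is a closed neighbourhood and
   when it is the whole vertex set. *)
have sum_gen (k : gT -> bool) (A : {set Gam}) : k 1 = false ->
    \big[addb/false]_(w in A) k (gpower_gen g u w)
    = odd #|A :&: closed_nbhd u| && k g.
  move=> k1; rewrite -odd_card_addb big_mkcond [RHS]big_mkcond /=.
  apply: eq_bigr => w _; rewrite ffunE !inE.
  by case: (w \in A) => //=; case: ifP.
split=> [v|].
  transitivity (\big[addb/false]_(w in closed_nbhd v)
                  (a (f w) (+) a (gpower_gen g u w))).
    by apply: eq_bigr => w _; rewrite ffunE aM.
  by rewrite big_split /= IHa sum_gen // (negbTE (evenG _ _)).
transitivity (\big[addb/false]_w (c (f w) (+) c (gpower_gen g u w)
               (+) (a (f w) && b (gpower_gen g u w)))).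
  by apply: eq_bigr => w _; rewrite ffunE cM.
rewrite !big_split /= IHc.
have -> : \big[addb/false]_w c (gpower_gen g u w) = false.
  transitivity (\big[addb/false]_(w in setT) c (gpower_gen g u w)).
    by apply: eq_bigl => w; rewrite inE.
  by rewrite sum_gen // setTI -[closed_nbhd u]setIid (negbTE (evenG _ _)).
transitivity (\big[addb/false]_(w in closed_nbhd u) (a (f w) && b g)).
  rewrite [RHS]big_mkcond; apply: eq_bigr => w _; rewrite ffunE.
  by case: ifP => // _; rewrite b1 andbF.
by rewrite -big_distrl /= IHa.
Qed.

(** The witness is a commutator placed at one vertex: it lies in the power of
    the derived subgroup, but its total [c] is odd. *)
Lemma even_overlap_not_RA (Gam : sgraph) (g h : gT) (v : Gam) :
    even_overlap Gam -> c [~ g, h] -> ~~ is_RA [set: gT] Gam.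
Proof.
move=> evenG cz; apply/subsetP => sub.
pose f : gpower_type gT Gam := finfun (fun w => if w == v then [~ g, h] else 1).
have [_ _ c1] := coord1.
have /sub/(gpower_parity evenG)[_] : f \in setXn (fun _ : Gam => [~: [set: gT], [set: gT]]).
  apply/setXnP => w; rewrite ffunE; case: ifP => _; last exact: group1.
  by rewrite mem_commg ?inE.
rewrite (bigD1 v) //= ffunE eqxx cz big1 // => w /negbTE nvw.
by rewrite ffunE nvw.
Qed.

End HeisenbergCoordinates.

(** * The dihedral group of order 8 as a Heisenberg group *)

(** The upper unitriangular matrices of size 3 over the field with two
    elements; in [(a, b, c)], [c] is the corner entry. *)
Definition heisenberg : Type := (bool * bool * bool)%type.

HB.instance Definition _ := Finite.on heisenberg.

Definition heis_mul (x y : heisenberg) : heisenberg :=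
  (x.1.1 (+) y.1.1, x.1.2 (+) y.1.2, x.2 (+) y.2 (+) (x.1.1 && y.1.2)).

Definition heis_inv (x : heisenberg) : heisenberg :=
  (x.1.1, x.1.2, x.2 (+) (x.1.1 && x.1.2)).

Lemma heis_mulA : associative heis_mul.
Proof. by do 3![case=> [[[] []] []]]. Qed.

Lemma heis_mul1 : left_id (false, false, false) heis_mul.
Proof. by case=> [[[] []] []]. Qed.

Lemma heis_mulV : left_inverse (false, false, false) heis_inv heis_mul.
Proof. by case=> [[[] []] []]. Qed.

HB.instance Definition _ :=
  Finite_isGroup.Build heisenberg heis_mulA heis_mul1 heis_mulV.

(** The presentation of [D_8] by two involutions whose product has order
    dividing 4 provides the morphism: the two triples satisfy these
    relations. *)
Lemma D8_heisenberg :
  exists2 phi : {morphism [set: 'D_8] >-> heisenberg},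
    exists g, phi g = (true, false, false)
  & exists h, phi h = (false, true, false).
Proof.
pose x : heisenberg := (true, false, false).
pose y : heisenberg := (false, true, false).
have /homgP[phi imphi] : <[x]> <*> <[y]> \homg [set: 'D_8].
  rewrite (@Grp'_dihedral 4) //; apply/existsP; exists (x, y).
  by rewrite /= !xpair_eqE eqxx.
have lift z : z \in <[x]> <*> <[y]> -> exists g, phi g = z.
  by rewrite -imphi => /morphimP[g _ _ ->]; exists g.
by exists phi; apply: lift;
  rewrite mem_gen // inE cycle_id ?orbT.
Qed.

(** The two reflections generating [D_8] do not commute, and their commutator
    has corner coordinate [1]. *)
Lemma D8_not_RA (Gam : sgraph) (v : Gam) :
  even_overlap Gam -> ~~ is_RA (gT := ('D_8)%type) [set: _] Gam.
Proof.
move=> evenG; have [phi [g phig] [h phih]] := D8_heisenberg.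
have phiM k l : phi (k * l) = heis_mul (phi k) (phi l).
  by rewrite morphM ?inE.
pose a k := (phi k).1.1; pose b k := (phi k).1.2; pose c k := (phi k).2.
have aM k l : a (k * l) = a k (+) a l by rewrite /a phiM.
have bM k l : b (k * l) = b k (+) b l by rewrite /b phiM.
have cM k l : c (k * l) = c k (+) c l (+) (a k && b l) by rewrite /c phiM.
apply: (even_overlap_not_RA aM bM cM (g := g) (h := h) v evenG).
by have [_ _ ->] := coord_commg aM bM cM g h; rewrite /a /b phig phih.
Qed.

(** * Cayley graphs of bit strings *)

Section BitStringCayley.

Variable m : nat.
Implicit Types (x y u v w : m.-tuple bool) (A : {set 'I_m}).

(** Addition of bit strings, the second one given by its support. *)
Definition flip x A : m.-tuple bool := [tuple tnth x i (+) (i \in A) | i < m].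

Lemma bit_diff_flip x A : bit_diff x (flip x A) = A.
Proof.
by apply/setP=> i; rewrite inE tnth_mktuple; case: (tnth x i) (i \in A) => [] [].
Qed.

Lemma flip_bit_diff x y : flip x (bit_diff x y) = y.
Proof.
apply: eq_from_tnth => i; rewrite tnth_mktuple inE.
by case: (tnth x i) (tnth y i) => [] [].
Qed.

Lemma bit_diff_eq0 x y : (bit_diff x y == set0) = (x == y).
Proof.
apply/eqP/eqP => [e|->]; last by apply/setP=> i; rewrite !inE eqxx.
by rewrite -(flip_bit_diff x y) e; apply: eq_from_tnth => i;
  rewrite tnth_mktuple inE addbF.
Qed.

(** For [v <> w], adding [v + w] exchanges [v + S] and [w + S], so it acts on
    their intersection; it moves every vertex, because it changes any bit [i] at
    which [v] and [w] differ.  For [v = w] the count is [#|S|]. *)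
Lemma even_overlap_Cayley (adj : rel (m.-tuple bool)) symA irrA
    (S : {set {set 'I_m}}) :
    (forall v w, (w == v) || adj v w = (bit_diff v w \in S)) ->
  ~~ odd #|S| -> even_overlap (@SGraph (m.-tuple bool) adj symA irrA).
Proof.
move=> adjE evenS v w.
have in_nbhd x y : (y \in closed_nbhd (x : SGraph symA irrA))
    = (bit_diff x y \in S) by rewrite inE adjE.
have [<-|neq_vw] := eqVneq v w.
  rewrite setIid (_ : closed_nbhd v = flip v @: S).
    by rewrite card_imset //; apply: can_inj (bit_diff_flip v).
  apply/setP=> u; rewrite in_nbhd; apply/idP/imsetP => [Su|[A SA ->]].
    by exists (bit_diff v u); rewrite ?flip_bit_diff.
  by rewrite bit_diff_flip.
have /set0Pn[i Di] : bit_diff v w != set0 by rewrite bit_diff_eq0.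
set N := _ :&: _; pose t u := flip u (bit_diff v w).
have tK : involutive t.
  move=> u; apply: eq_from_tnth => j; rewrite !tnth_mktuple.
  by rewrite -addbA addbb addbF.
have tN u : (t u \in N) = (u \in N).
  have diff_tv : bit_diff v (t u) = bit_diff w u.
    apply/setP=> j; rewrite !inE tnth_mktuple inE.
    by case: (tnth u j) (tnth v j) (tnth w j) => [] [] [].
  have diff_tw : bit_diff w (t u) = bit_diff v u.
    apply/setP=> j; rewrite !inE tnth_mktuple inE.
    by case: (tnth u j) (tnth v j) (tnth w j) => [] [] [].
  by rewrite !in_setI !in_nbhd diff_tv diff_tw andbC.
(* The involution exchanges the two halves of [N] cut out by the bit [i]. *)
pose B := [set u : m.-tuple bool | tnth u i].
rewrite -(cardsID B N) (_ : N :\: B = t @: (N :&: B)).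
  by rewrite card_imset ?addnn ?odd_double //; apply: can_inj tK.
apply/setP=> u; rewrite -[u in RHS]tK mem_imset; last exact: can_inj tK.
rewrite in_setD [in RHS]in_setI tN andbC; congr (_ && _).
by rewrite !in_set tnth_mktuple Di addbT.
Qed.

End BitStringCayley.

(** * Cubes and folded cubes *)

(** The connection set of the cube, the empty set standing for the vertex
    itself. *)
Definition small_sets (m : nat) : {set {set 'I_m}} := [set A : {set 'I_m} | #|A| <= 1].

Lemma card_small_sets m : #|small_sets m| = m.+1.
Proof.
rewrite (_ : small_sets m = set0 |: [set A : {set 'I_m} | #|A| == 1%N]).
  rewrite cardsU1 card_draws card_ord bin1 inE cards0 //.
by apply/setP=> A; rewrite !inE leq_eqVlt ltnS leqn0 cards_eq0 orbC.
Qed.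

Lemma mem_small_sets m (x y : m.-tuple bool) :
  (bit_diff x y \in small_sets m) = (y == x) || cube_adj x y.
Proof.
by rewrite inE leq_eqVlt ltnS leqn0 cards_eq0 bit_diff_eq0 orbC eq_sym.
Qed.

Lemma opposite_bit_diff m (x y : m.-tuple bool) :
  opposite x y = (bit_diff x y == setT).
Proof.
apply/eqP/eqP => [->|e].
  by apply/setP=> i; rewrite !inE tnth_map; case: (tnth x i).
rewrite -(flip_bit_diff x y) e; apply: eq_from_tnth => i.
by rewrite tnth_mktuple tnth_map inE addbT.
Qed.

Lemma cube_even_overlap d : odd d -> even_overlap (cube_graph d).
Proof.
move=> odd_d; apply: (even_overlap_Cayley (S := small_sets d)).
  by move=> v w; rewrite mem_small_sets.
by rewrite card_small_sets /= odd_d.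
Qed.

(** The connection set gains the full set.  For [d = 2] the full set is already
    a singleton, which is why this even [d] also gives an even connection
    set. *)
Lemma folded_cube_even_overlap d :
  2 <= d -> odd d \/ d = 2 -> even_overlap (folded_cube_graph d).
Proof.
move=> d_ge2 dP.
apply: (even_overlap_Cayley (S := setT |: small_sets d.-1)).
  move=> v w; rewrite inE mem_small_sets inE -opposite_bit_diff.
  rewrite /cube_opp_adj [v == w]eq_sym.
  by case: eqP => //=; rewrite ?orbT // orbC.
rewrite cardsU1 card_small_sets inE cardsT card_ord prednK; last exact: ltnW.
case: dP => [|-> //]; case: d d_ge2 => [|[|[|d]]] //= _.
by rewrite !negbK.
Qed.

Local Close Scope group_scope.

Theorem corollary6p14 :
  (forall d : nat, 1 <= d -> odd d -> ~~ is_RA (gT := 'D_8) [set: _] (cube_graph d))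
  /\
  (forall d : nat, 2 <= d -> odd d \/ d = 2 ->
     ~~ is_RA (gT := 'D_8) [set: _] (folded_cube_graph d)).
Proof.
split=> d d_ge.
  by move=> /cube_even_overlap; apply: D8_not_RA; exact: [tuple of nseq d false].
move=> /(folded_cube_even_overlap d_ge); apply: D8_not_RA.
exact: [tuple of nseq d.-1 false].
Qed.
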